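(* Let $G$ be a finite, simple, connected, undirected graph. Then $G$ is a union of two cliques if and only if for every integer $n \ge 1$, $G$ does not have $C_{2n+1}^{C}$ as an induced subgraph.
   Context: $C_k$ denotes the cycle on $k$ vertices, and $H^{C}$ denotes the complement of a graph $H$; in particular $C_3^{C} = 3K_1$ (three pairwise non-adjacent vertices). A graph $G$ is a union of two cliques if $V(G) = Q_1 \cup Q_2$ where $Q_1$ and $Q_2$ each induce a complete subgraph of $G$ (the sets $Q_1, Q_2$ need not be disjoint and may be empty; there may be further edges between $Q_1$ and $Q_2$). ''$G$ has $H$ as an induced subgraph'' means that some subset of $V(G)$ induces a subgraph isomorphic to $H$. *)

(* Defs.v *)
From mathcomp Require Import all_boot.
Set Implicit Arguments.
Unset Strict Implicit.
Unset Printing Implicit Defensive.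

Record sgraph := SGraph {
  vertex :> finType;
  adj : rel vertex;
  adj_sym : symmetric adj;
  adj_irr : irreflexive adj
}.

Section Complement.
Variable G : sgraph.
Definition compl_adj : rel G := fun x y => (x != y) && ~~ adj x y.
Lemma compl_adj_sym : symmetric compl_adj.
Proof. by move=> x y; rewrite /compl_adj eq_sym adj_sym. Qed.
Lemma compl_adj_irr : irreflexive compl_adj.
Proof. by move=> x; rewrite /compl_adj eqxx. Qed.
Definition complement : sgraph := SGraph compl_adj_sym compl_adj_irr.
End Complement.

(* The cycle is meant for k >= 3. The conjunct i != j only matters for k = 1,
   where ordS has a fixed point. *)
Section Cycle.
Variable k : nat.
Definition cycle_adj : rel 'I_k :=
  fun i j => (i != j) && ((j == ordS i) || (i == ordS j)).
Lemma cycle_adj_sym : symmetric cycle_adj.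
Proof. by move=> i j; rewrite /cycle_adj eq_sym orbC. Qed.
Lemma cycle_adj_irr : irreflexive cycle_adj.
Proof. by move=> i; rewrite /cycle_adj eqxx. Qed.
Definition cycle_graph : sgraph := SGraph cycle_adj_sym cycle_adj_irr.
End Cycle.

Section Induced.
Variables (G : sgraph) (S : {set G}).
Definition induced_adj : rel {x : G | x \in S} :=
  fun u v => adj (val u) (val v).
Lemma induced_adj_sym : symmetric induced_adj.
Proof. by move=> u v; apply: adj_sym. Qed.
Lemma induced_adj_irr : irreflexive induced_adj.
Proof. by move=> u; apply: adj_irr. Qed.
Definition induced : sgraph := SGraph induced_adj_sym induced_adj_irr.
End Induced.

Definition isomorphic (G H : sgraph) : Prop :=
  exists f : G -> H, bijective f /\ (forall x y, adj (f x) (f y) = adj x y).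

Definition has_induced_subgraph (G H : sgraph) : Prop :=
  exists S : {set G}, isomorphic (induced S) H.

(* The graph without vertices counts as connected. *)
Definition connected_graph (G : sgraph) : Prop :=
  forall x y : G, connect (@adj G) x y.

Definition is_clique (G : sgraph) (Q : {set G}) : Prop :=
  {in Q &, forall x y, x != y -> adj x y}.

Definition union_of_two_cliques (G : sgraph) : Prop :=
  exists Q1 Q2 : {set G},
    [/\ Q1 :|: Q2 = [set: G], is_clique Q1 & is_clique Q2].

(* Main.v *)
Require Import Defs.
From mathcomp Require Import all_boot.
Set Implicit Arguments.
Unset Strict Implicit.
Unset Printing Implicit Defensive.

(** Passing to the complement H of G, a union of two cliques becomes a proper
    2-colouring of H ([union_of_two_cliquesP]) and an induced complement of a
    cycle in G becomes an induced cycle of H, so the theorem says that a graph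
    is bipartite exactly when it has no induced odd cycle.

    An odd cycle has no proper 2-colouring: rotating it by one step exchanges
    the two colour classes, which would then have the same size
    ([odd_cycle_not_2colourable]).

    Conversely, consider the bipartite double cover of H, in which (x, b) and
    (y, c) are adjacent when x and y are adjacent in H and b differs from c.
    A path from (x, true) to (x, false) projects to a closed walk of odd length
    in H.  If there is no such walk, the components of (x, true) and (x, false)
    always differ, and they are exchanged when x is replaced by a neighbour;
    comparing them in any fixed total order of the components is thus a proper
    2-colouring ([no_odd_closed_walk_2colourable]).  If there is one, then a
    shortest one is an induced cycle: a repeated vertex, or an edge joining two
    vertices that are not consecutive, would split it into two closed walks,
    one of them odd and shorter; it has at least three vertices because H has
    no loops ([shortest_odd_closed_walk_induced]). *)

(** * Induced subgraphs as embeddings *)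

(** An embedding can be composed with a colouring of G or read off from a walk
    in G, without handling the subtype of vertices in the definition. *)
Lemma has_induced_subgraphP (G H : sgraph) :
  has_induced_subgraph G H <->
  exists2 g : H -> G, injective g & forall i j, adj (g i) (g j) = adj i j.
Proof.
split=> [[S [f [[f' fK f'K] f_adj]]] | [g g_inj g_adj]].
  exists (fun i => val (f' i)) => [i j /val_inj | i j].
    exact: (can_inj f'K).
  by rewrite -[in RHS](f'K i) -[in RHS](f'K j) f_adj.
pose S : {set G} := [set x in codom g].
have S_codom (u : induced S) : val u \in codom g.
  by have := valP u; rewrite inE.
have codom_S i : g i \in S by rewrite inE codom_f.
exists S, (fun u => iinv (S_codom u)); split.
  exists (fun i => exist _ (g i) (codom_S i)) => [u | i].
    by apply: val_inj; rewrite /= f_iinv.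
  by apply: g_inj; rewrite f_iinv.
by move=> u v; rewrite -g_adj !f_iinv.
Qed.

Lemma has_induced_complement (G H : sgraph) (g : H -> G) :
  injective g -> (forall i j, adj (g i : complement G) (g j) = adj i j) ->
  has_induced_subgraph G (complement H).
Proof.
move=> g_inj g_adj; apply/has_induced_subgraphP; exists g => // i j.
have := g_adj i j; rewrite /= /compl_adj (inj_eq g_inj) => <-.
by have [-> | _] /= := eqVneq; rewrite ?adj_irr ?negbK.
Qed.

(** * Proper 2-colourings *)

Definition proper_2colouring (G : sgraph) (c : G -> bool) : Prop :=
  forall x y, adj x y -> c x != c y.

(** The cliques may overlap, so only membership in the first one is used as a
    colour; vertices outside it all lie in the second. *)
Lemma union_of_two_cliquesP (G : sgraph) :
  union_of_two_cliques G <->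
  exists c : G -> bool, proper_2colouring (c : complement G -> bool).
Proof.
split=> [[Q1 [Q2 [QT Q1_clique Q2_clique]]] | [c c_proper]].
  exists (fun x => x \in Q1) => x y /andP[xDy xNy].
  apply: contraNneq xNy; case: (boolP (y \in Q1)) => yQ xQ.
    exact: Q1_clique.
  have inQ2 z : z \notin Q1 -> z \in Q2.
    by move=> /negPf zQ; have := in_setT z; rewrite -QT inE zQ.
  by apply: Q2_clique => //; apply: inQ2; rewrite ?xQ.
have mono_clique b : is_clique [set x | c x == b].
  move=> x y; rewrite !inE => /eqP cx /eqP cy xDy.
  apply: contraTT isT => xNy; have := c_proper x y.
  by rewrite /= /compl_adj xDy xNy cx cy eqxx => /(_ isT).
exists [set x | c x == true], [set x | c x == false].
split; [apply/setP=> x | exact: mono_clique | exact: mono_clique].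
by rewrite !inE; case: (c x).
Qed.

Lemma cycle_adj_ordS n (i : cycle_graph n) : 1 < n -> adj i (ordS i : 'I_n).
Proof.
move=> n_gt1; rewrite /= /cycle_adj eqxx /= andbT.
apply/eqP=> /(congr1 val) /=; have i_lt := ltn_ord i.
case: (ltngtP i.+1 n) => [lt | | i_last]; last 1 first.
- by rewrite i_last modnn => i0; move: n_gt1; rewrite -i_last i0.
- by rewrite modn_small // => /n_Sn.
by rewrite ltnNge i_lt.
Qed.

(** The rotation [ordS] is a bijection that exchanges the two colour classes, so
    the number of vertices is twice the size of one class. *)
Lemma odd_cycle_not_2colourable n (c : cycle_graph n -> bool) :
  1 < n -> odd n -> ~ proper_2colouring c.
Proof.
move=> n_gt1 n_odd c_proper; pose A := [set i : 'I_n | c i].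
have shiftA : @ordS n @^-1: A = ~: A.
  apply/setP=> i; rewrite !inE.
  have := c_proper _ _ (cycle_adj_ordS i n_gt1).
  by case: (c i); case: (c (ordS i)).
have := cardsC A; rewrite -shiftA card_preimset ?card_ord; last exact: ordS_inj.
by rewrite addnn => n_even; move: n_odd; rewrite -n_even odd_double.
Qed.

(** * Odd closed walks *)

Section ClosedWalks.
Variables (T : finType) (e : rel T).
Hypothesis e_sym : symmetric e.

(** The walk visits the entries of [s] in order and returns to the first, so
    [size s] is the number of its steps. *)
Definition odd_closed_walk (s : seq T) := cycle e s && odd (size s).

Definition shortest_odd_closed_walk s :=
  odd_closed_walk s /\ forall t, odd_closed_walk t -> size s <= size t.

Lemma exists_shortest_odd_closed_walk s :
  odd_closed_walk s -> exists t, shortest_odd_closed_walk t.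
Proof.
(* Walks of a given length form a finite type, so [P] is decidable and holds
   at a least length. *)
pose P n := odd n && [exists t : n.-tuple T, cycle e t].
have P_size t : odd_closed_walk t -> P (size t).
  case/andP=> et t_odd; rewrite /P t_odd.
  by apply/existsP; exists (in_tuple t).
move=> /P_size s_odd; have exP : exists n, P n by exists (size s).
case: (ex_minnP exP) => n /andP[n_odd /existsP[t et]] n_min.
exists t; split=> [|u /P_size]; first by rewrite /odd_closed_walk et size_tuple.
by rewrite size_tuple; apply: n_min.
Qed.

Lemma shortest_odd_closed_walk_rot i s :
  shortest_odd_closed_walk s -> shortest_odd_closed_walk (rot i s).
Proof.
by rewrite /shortest_odd_closed_walk /odd_closed_walk rot_cycle size_rot.
Qed.

(** If x and y coincide, the walk splits at them into the closed walks [x :: s1]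
    and [y :: s2], whose lengths have an odd sum. *)
Lemma shortest_odd_closed_walk_neq x s1 y s2 :
  shortest_odd_closed_walk (x :: s1 ++ y :: s2) -> x != y.
Proof.
case=> /andP[]; rewrite /= rcons_cat cat_path rcons_cons /= size_cat /= addnS.
case/and3P=> es1 ey es2; rewrite /= negbK oddD => s_odd s_min.
apply/eqP=> xy; subst y.
have es1x : path e x (rcons s1 x) by rewrite rcons_path es1.
have := s_min (x :: s1); have := s_min (x :: s2).
rewrite /odd_closed_walk /= es1x es2 /= !ltnS => min2 min1.
case: (boolP (odd (size s1))) => odd1 in s_odd min1 min2.
  move: s_odd min2 => /= /negPf -> /(_ isT).
  by rewrite leqNgt ltnS leq_addl.
by move: min1 => /(_ isT); rewrite leqNgt ltnS leq_addr.
Qed.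

(** An edge between x and y closes up both arcs of the walk, into closed walks
    with [size s1 + 2] and [size s2 + 2] steps.  Exactly one of the two numbers
    is odd, and by minimality the opposite arc has no interior vertex.  If an
    arc has no interior vertex, its single step is the edge. *)
Lemma shortest_odd_closed_walk_chord x s1 y s2 :
  shortest_odd_closed_walk (x :: s1 ++ y :: s2) ->
  e x y = nilp s1 || nilp s2.
Proof.
case=> /andP[]; rewrite /= rcons_cat cat_path rcons_cons /= size_cat /= addnS.
case/and3P=> es1 ey es2; rewrite /= negbK oddD => s_odd s_min.
apply/idP/orP=> [exy | [/nilP s10 | /nilP s20]]; last first.
- by move: es2; rewrite s20 /= andbT e_sym.
- by move: ey; rewrite s10.
have := s_min (x :: rcons s1 y); have := s_min (y :: rcons s2 x).
rewrite /odd_closed_walk /= !rcons_path !last_rcons !size_rcons.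
rewrite (e_sym y) exy es1 ey -rcons_path es2 /= !negbK !ltnS => min2 min1.
case: (boolP (odd (size s1))) => odd1 in s_odd min1 min2.
  by right; move: (min1 isT); rewrite -[leqRHS]addn0 leq_add2l leqn0.
by left; move: (min2 s_odd); rewrite -[leqRHS]add0n leq_add2r leqn0.
Qed.

(** The two preceding facts at arbitrary positions, obtained by rotating the
    walk so that it starts at position [i]. *)
Lemma shortest_odd_closed_walk_nth x0 s i j :
    shortest_odd_closed_walk s -> i < j < size s ->
  nth x0 s i != nth x0 s j /\
  e (nth x0 s i) (nth x0 s j) = (j == i.+1) || (i == 0) && (j.+1 == size s).
Proof.
move=> s_min /andP[ij j_lt]; have i_lt := ltn_trans ij j_lt.
pose s1 := take (j - i.+1) (drop i.+1 s); pose s2 := drop j.+1 s ++ take i s.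
have rot_s : rot i s = nth x0 s i :: s1 ++ nth x0 s j :: s2.
  rewrite /rot (drop_nth x0 i_lt) -cat_cons /s2 -[RHS]cat_cons -cat_cons catA.
  congr (_ ++ _); rewrite /= -(drop_nth x0 j_lt) /s1.
  by rewrite -{1}(cat_take_drop (j - i.+1) (drop i.+1 s)) drop_drop subnK.
have := shortest_odd_closed_walk_rot i s_min; rewrite rot_s => rot_min.
split; first exact: shortest_odd_closed_walk_neq rot_min.
rewrite (shortest_odd_closed_walk_chord rot_min) /nilp /s1 /s2.
rewrite size_cat size_drop size_takel; last first.
  by rewrite size_drop leq_sub2r // ltnW.
rewrite size_takel ?(ltnW i_lt) // addn_eq0 !subn_eq0.
by rewrite andbC [j == _]eqn_leq ij andbT [_ == size s]eqn_leq j_lt.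
Qed.

End ClosedWalks.

Lemma shortest_odd_closed_walk_induced (G : sgraph) (s : seq G) :
  shortest_odd_closed_walk (@adj G) s ->
  exists2 g : cycle_graph (size s) -> G,
    injective g & forall i j, adj (g i) (g j) = adj i j.
Proof.
move=> s_min.
have x0 : G by case: s s_min => [[] | x].
have nthP := shortest_odd_closed_walk_nth (@adj_sym G) x0 s_min.
have g_lt (i j : 'I_(size s)) : i < j ->
    nth x0 s i != nth x0 s j /\
    adj (nth x0 s i) (nth x0 s j) = adj (i : cycle_graph _) j.
  move=> ij; have [|-> ->] := nthP i j; first by rewrite ij ltn_ord.
  split=> //; rewrite /= /cycle_adj -!val_eqE /= neq_ltn ij /=.
  rewrite modn_small; last exact: leq_ltn_trans ij (ltn_ord j).
  congr (_ || _); have := ltn_ord j; rewrite leq_eqVlt => /predU1P[-> | j_lt].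
    by rewrite modnn eqxx andbT.
  by rewrite modn_small // [j.+1 == _]ltn_eqF // andbF ltn_eqF // ltnS ltnW.
exists (fun i : 'I_(size s) => nth x0 s i) => [i j | i j].
  move=> eq_ij; apply/val_inj; case: (ltngtP i j) => // /g_lt[];
  by rewrite eq_ij eqxx.
case: (ltngtP i j) => [/g_lt[] // | /g_lt[_] | /val_inj ->].
  by rewrite adj_sym => ->; apply: adj_sym.
by rewrite !adj_irr.
Qed.

(** * The bipartite double cover *)

Section DoubleCover.
Variable G : sgraph.

Definition cover_adj : rel (G * bool) :=
  fun u v => adj u.1 v.1 && (u.2 != v.2).

Lemma cover_connect_sym : connect_sym cover_adj.
Proof.
by apply: sym_connect_sym => u v; rewrite /cover_adj adj_sym eq_sym.
Qed.

(** Each step of the cover flips the second component, so it records the parity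
    of the length of the projected walk. *)
Lemma cover_path u p :
  path cover_adj u p ->
  path (@adj G) u.1 (unzip1 p) /\ (last u p).2 = u.2 (+) odd (size p).
Proof.
elim: p u => [|v p IHp] u /=; first by rewrite addbF.
case/andP=> /andP[-> uv] /IHp[-> ->]; split=> //.
by case: u.2 uv; case: v.2 => //=; case: odd.
Qed.

Lemma cover_connect_odd_closed_walk x :
  connect cover_adj (x, true) (x, false) ->
  exists s, odd_closed_walk (@adj G) s.
Proof.
case/connectP=> p /cover_path[]; case/lastP: p => //= p v.
rewrite last_rcons size_rcons => walk + eq_v; rewrite -{}eq_v in walk *.
rewrite /= negbK => p_even; exists (x :: unzip1 p).
rewrite /odd_closed_walk /= size_map -p_even andbT.
by rewrite /unzip1 map_rcons in walk.
Qed.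

Lemma no_odd_closed_walk_2colourable :
  (forall s, ~ odd_closed_walk (@adj G) s) ->
  exists c : G -> bool, proper_2colouring c.
Proof.
move=> no_odd.
(* The rank of a representative identifies and orders the components. *)
pose r x b := enum_rank (root cover_adj (x, b)).
have r_neq x : r x true != r x false.
  rewrite (inj_eq enum_rank_inj) (root_connect cover_connect_sym).
  by apply/negP=> /cover_connect_odd_closed_walk[s]; apply: no_odd.
have r_adj x y b : adj x y -> r x b = r y (~~ b).
  move=> xy; congr enum_rank; apply/eqP.
  rewrite (root_connect cover_connect_sym) connect1 // /cover_adj xy /=.
  by case: b.
exists (fun x => r x true < r x false) => x y xy.
rewrite !(r_adj x y) //=.
by have := r_neq y; rewrite -val_eqE /=; case: ltngtP.
Qed.

End DoubleCover.

Theorem mainTheorem1 (G : sgraph) (G_connected : connected_graph G) :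
  union_of_two_cliques G <->
  (forall n : nat, 1 <= n ->
     ~ has_induced_subgraph G (complement (cycle_graph (2 * n + 1)))).
Proof.
split=> [/union_of_two_cliquesP[c c_proper] n n_gt0 | no_cycle].
  case/has_induced_subgraphP=> g g_inj g_adj.
  apply: (@odd_cycle_not_2colourable _ (c \o g)).
  - by rewrite addn1 ltnS muln_gt0.
  - by rewrite oddD oddM.
  move=> i j ij; apply: c_proper; have := g_adj i j.
  rewrite /= /compl_adj (inj_eq g_inj) => ->.
  by move: ij => /= ij; rewrite ij andbF andbT; case/andP: ij.
apply/union_of_two_cliquesP.
apply: (@no_odd_closed_walk_2colourable (complement G)) => s.
case/exists_shortest_odd_closed_walk=> {}s s_min.
have [/andP[s_walk s_odd] _] := s_min.
have half_gt0 : 0 < (size s)./2.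
  case: s s_walk s_odd {s_min} => [|x [|y [|z s]]] //=.
  by rewrite /compl_adj eqxx.
have [g g_inj g_adj] := shortest_odd_closed_walk_induced s_min.
have sizeE : 2 * (size s)./2 + 1 = size s.
  by rewrite mul2n addnC -[RHS]odd_double_half s_odd.
apply: (no_cycle _ half_gt0); rewrite sizeE.
exact: (@has_induced_complement G _ g).
Qed.
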